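(* Let $\mathcal{G}$ be any connected weighted undirected graph on $V=\{1,\dots,n\}$, let $V_L=\{v_1,\dots,v_m\}\subset V$ be a set of $m$ leader agents, and let $r\in\{1,\dots,m\}$. Suppose that $V_{\rm demotion}\subset V_L$ with $|V_{\rm demotion}|=r$, and that the new leader set is $\tilde V_L^*=V_L\setminus V_{\rm demotion}$, indexed by $\tilde v_l=v_l$ for all $l$ with $v_l\notin V_{\rm demotion}$. Then $$\frac{\|G-\tilde G\|_{H^2}}{\|G\|_{H^2}}=\sqrt{\frac{r}{m}},$$ where $G$ is the transfer function of the original system with leader set $V_L$ and $\tilde G$ is the transfer function of the new system with leader set $\tilde V_L^*$.
   Context: Graph: $\mathcal{G}=(V,E,A)$ is a connected weighted undirected graph with vertex set $V=\{1,\dots,n\}$, edge set $E$ and symmetric adjacency matrix $A=(a_{ij})$, where $a_{ij}=a_{ji}>0$ is the weight of the edge if $\{i,j\}$ is an edge and $a_{ij}=0$ otherwise (there are no self-loops, so $a_{ii}=0$). The degree matrix is $D={\rm diag}(d_1,\dots,d_n)$, $d_i=\sum_{j=1}^n a_{ij}$, and the Laplacian is $L=D-A$. Number the edges $1,\dots,k$, let $W={\rm diag}(w_1,\dots,w_k)$ be the diagonal matrix of edge weights, orient each edge arbitrarily, and let $R\in\mathbf{R}^{n\times k}$ be the incidence matrix: $R_{ij}=1$ if vertex $i$ is the source of edge $j$, $R_{ij}=-1$ if vertex $i$ is the sink of edge $j$, and $R_{ij}=0$ otherwise. (Then $L=RWR^T$.) Original system: $V_L=\{v_1,\dots,v_m\}\subset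 V$ consists of $m$ distinct vertices. $M\in\mathbf{R}^{n\times m}$ has $M_{il}=1$ if $i=v_l$ and $M_{il}=0$ otherwise. The system is $\dot x=-Lx+Mu$, $y=W^{1/2}R^Tx$, with state $x\in\mathbf{R}^n$, input $u\in\mathbf{R}^m$, output $y\in\mathbf{R}^k$, and transfer function $G(s)=W^{1/2}R^T(sI_n+L)^{-1}M$, where $I_n$ is the identity matrix of size $n$. New system: $V_{\rm demotion}=\{v_l: l\in J\}\subset V_L$, $J\subset\{1,\dots,m\}$, is the set of leaders demoted to followers. For a new leader set $\tilde V_L=\{\tilde v_l: l\in\{1,\dots,m\}\setminus J\}$ of pairwise distinct vertices of $V\setminus V_{\rm demotion}$, $\tilde M\in\mathbf{R}^{n\times m}$ has $\tilde M_{il}=1$ if $l\notin J$ and $i=\tilde v_l$, and $\tilde M_{il}=0$ otherwise (so the columns with index in $J$ are zero). The system is $\dot{\tilde x}=-L\tilde x+\tilde Mu$, $\tilde y=W^{1/2}R^T\tilde x$, with transfer function $\tilde G(s)=W^{1/2}R^T(sI_n+L)^{-1}\tilde M$. Norm: for a matrix function $H(s)$, $\|H\|_{H^2}=\sqrt{\frac{1}{2\pi}\int_{-\infty}^{\infty}\|H(i\omega)\|_F^2\,d\omega}$, where $i$ in $i\omega$ is the imaginary unit, $\|B\|_F=\sqrt{{\rm tr}(B^\dagger B)}$ is the Frobenius norm and $\dagger$ is Hermitian conjugation. *)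

(* Defs.v *)
From HB Require Import structures.
From mathcomp Require Import all_boot all_order all_algebra.
From mathcomp Require Import complex.
From mathcomp Require Import all_classical all_reals all_analysis.

Set Implicit Arguments.
Unset Strict Implicit.
Unset Printing Implicit Defensive.

Import Order.TTheory GRing.Theory Num.Theory.

Local Open Scope ring_scope.
Local Open Scope complex_scope.

Section WeightedGraph.
Variables (R : realType) (n : nat).
Implicit Type A : 'M[R]_n.

Record connected_wgraph A : Prop := ConnectedWgraph {
  wgraph_sym : forall i j, A i j = A j i;
  wgraph_ge0 : forall i j, 0 <= A i j;
  wgraph_loopless : forall i, A i i = 0;
  wgraph_connected : forall i j, connect [rel x y | 0 < A x y] i j
}.

Definition edges A : {set {set 'I_n}} :=
  [set S | [exists i, exists j, (0 < A i j) && (S == [set i; j])]].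

Definition degree_mx A : 'M[R]_n := diag_mx (\row_i \sum_j A i j).

Definition laplacian A : 'M[R]_n := degree_mx A - A.

(* Edge number e is {src e, snk e}, oriented from src e to snk e; every edge is
   numbered exactly once. *)
Definition oriented_edge_numbering A (k : nat) (src snk : 'I_k -> 'I_n) : Prop :=
  injective (fun e => [set src e; snk e]) /\
  [set [set src e; snk e] | e : 'I_k] = edges A.

Definition incidence_mx (k : nat) (src snk : 'I_k -> 'I_n) : 'M[R]_(n, k) :=
  \matrix_(i, e) (if i == src e then 1 else if i == snk e then -1 else 0).

(* The square root of the diagonal matrix of the edge weights. *)
Definition sqrt_weight_mx A (k : nat) (src snk : 'I_k -> 'I_n) : 'M[R]_k :=
  diag_mx (\row_e Num.sqrt (A (src e) (snk e))).

Definition leader_mx (m : nat) (v : 'I_m -> 'I_n) : 'M[R]_(n, m) :=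
  \matrix_(i, l) (i == v l)%:R.

(* The columns with index in J vanish; the values of v on J are irrelevant. *)
Definition new_leader_mx (m : nat) (J : {set 'I_m}) (v : 'I_m -> 'I_n) :
    'M[R]_(n, m) :=
  \matrix_(i, l) ((l \notin J) && (i == v l))%:R.

(* W^(1/2) R^T (s I + L)^-1 B.  If s I + L is singular then invmx is the
   identity function; on the imaginary axis this happens only at s = 0, hence
   does not affect the H2 norm. *)
Definition transfer A (k : nat) (src snk : 'I_k -> 'I_n) (m : nat)
    (B : 'M[R]_(n, m)) (s : R[i]) : 'M[R[i]]_(k, m) :=
  map_mx (real_complex R)
      (sqrt_weight_mx A src snk *m (incidence_mx src snk)^T)
    *m invmx (s%:M + map_mx (real_complex R) (laplacian A))
    *m map_mx (real_complex R) B.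

End WeightedGraph.

Section H2norm.
Variables (R : realType) (p q : nat).

(* tr (B^dagger B) is a nonnegative real number, so Re only changes its type. *)
Definition frobenius_norm (B : 'M[R[i]]_(p, q)) : R :=
  Num.sqrt (complex.Re (\tr ((map_mx Num.conj B)^T *m B))).

(* Valued in the extended reals: the integral may diverge for a general H. *)
Definition H2norm (H : R[i] -> 'M[R[i]]_(p, q)) : \bar R :=
  sqrte (((2 * pi)^-1)%:E *
    \int[@lebesgue_measure R]_(w in setT)
      ((frobenius_norm (H ('i * w%:C)) ^+ 2)%:E))%E.

End H2norm.

(* Main.v *)
Require Import Defs.
From HB Require Import structures.
From mathcomp Require Import all_boot all_order all_algebra.
From mathcomp Require Import complex spectral.
From mathcomp Require Import all_classical all_reals all_analysis.
From mathcomp Require Import measurable_realfun ring.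

Set Implicit Arguments.
Unset Strict Implicit.
Unset Printing Implicit Defensive.

Import Order.TTheory GRing.Theory Num.Theory.
Import numFieldNormedType.Exports.

Local Open Scope ring_scope.

(** Every leader contributes the same amount to the squared H2 norm, so
demoting r of the m leaders moves the fraction r / m of it into the difference
of the two transfer functions.

Both G and G - Gt have the shape W^(1/2) R^T (s I + L)^-1 S, where the columns
of S are the unit vectors of the leaders in some set K and zero elsewhere: K
is the whole index set for G, and the set of demoted indices for G - Gt.  It
remains to compute the H2 norm of such a system ([H2norm_transfer]): its square
is #|K| (1 - 1/n) / 2, whichever vertices the leaders are.

With B = W^(1/2) R^T one has L = B^T B ([laplacian_gram]).  Diagonalize
L = U diag(lam) U^* with U unitary and lam >= 0.  Off w = 0 the squared
Frobenius norm of the transfer function at i w is then a sum of Lorentzians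
([frobenius_transfer]),

  sum over l in K and a of |U_(v l, a)|^2 lam_a / (lam_a^2 + w^2),

and each Lorentzian with lam_a > 0 integrates to pi ([integral_lorentzian]).
So leader i contributes to the integral pi times the sum of |U_(i, a)|^2 over
lam_a <> 0, the squared length of the projection of the unit vector of i onto
the orthogonal complement of the kernel of L.  As the graph is connected, that kernel is the
line of constant vectors, and the squared length is 1 - 1/n for every vertex
([nonkernel_weight]).  It is positive because n > 1, which makes the quotient
of the norms meaningful. *)

(** * The Lorentzian integral *)

Lemma continuous_lorentzian (R : realType) (lam : R) : 0 < lam ->
  continuous (fun w : R => lam / (lam ^+ 2 + w ^+ 2)).
Proof.
move=> lam0 w; apply: cvgM; first exact: cvg_cst.
apply: cvgV; first by rewrite gt_eqF// ltr_pwDl ?exprn_gt0 ?sqr_ge0.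
by apply: cvgD; [exact: cvg_cst | exact: exprn_continuous].
Qed.

Lemma derivative_scaled_atan (R : realType) (lam w : R) : 0 < lam ->
  is_derive w 1 (fun t => atan (lam^-1 * t)) (lam / (lam ^+ 2 + w ^+ 2)).
Proof.
move=> lam0.
have -> : lam / (lam ^+ 2 + w ^+ 2) = (1 + (lam^-1 * w) ^+ 2)^-1 * lam^-1.
  rewrite -invfM; apply: invr_inj; rewrite invf_div invrK exprMn exprVn.
  have ? : lam != 0 by rewrite gt_eqF.
  by field.
have dl : is_derive w 1 (fun t : R => lam^-1 * t) lam^-1.
  by apply: is_derive_eq; rewrite /GRing.scale/= mulr1.
have := is_derive1_comp (is_derive1_atan (lam^-1 * w)) dl.
by [].
Qed.

(** The integrand is even with primitive atan (w / lam), which tends to pi / 2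
at infinity; the two half-lines contribute pi / 2 each. *)
Lemma integral_lorentzian (R : realType) (lam : R) : 0 < lam ->
  (\int[@lebesgue_measure R]_w (lam / (lam ^+ 2 + w ^+ 2))%:E = pi%:E)%E.
Proof.
move=> lam0; have cf := continuous_lorentzian lam0.
have f0 w : 0 <= lam / (lam ^+ 2 + w ^+ 2).
  by rewrite divr_ge0 ?addr_ge0 ?sqr_ge0 ?ltW.
rewrite ge0_symfun_integralT//; last by move=> w /=; rewrite sqrrN.
rewrite -set_itvcy (@ge0_continuous_FTC2y _ _ (fun t => atan (lam^-1 * t)) _ (pi / 2)).
- rewrite mulr0 atan0 sube0 -EFinM; congr EFin; by field.
- by [].
- exact: continuous_subspaceT.
- apply: (cvg_comp (fun t => lam^-1 * t) atan); last exact: cvgy_atan.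
  by apply: gt0_cvgMry; [rewrite invr_gt0 | exact: cvg_id].
- by move=> w _; have [] := derivative_scaled_atan w lam0.
- apply: cvg_at_right_filter.
  have [/derivable1_diffP/differentiable_continuous + _] := derivative_scaled_atan 0 lam0.
  exact.
- by move=> w _; rewrite derive1E; have [_ ->] := derivative_scaled_atan w lam0.
Qed.

Lemma measurable_lorentzian (R : realType) (lam : R) : 0 <= lam ->
  measurable_fun [set: R] (fun w : R => lam / (lam ^+ 2 + w ^+ 2)).
Proof.
rewrite le_eqVlt => /predU1P[<-|lam0].
  rewrite (_ : (fun _ => _) = cst 0); first exact: measurable_cst.
  by apply/funext => w; rewrite mul0r.
by apply: continuous_measurable_fun; exact: continuous_lorentzian.
Qed.

(** The constant eigenvectors of a Laplacian have lam = 0, so the degenerate case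
occurs; it contributes nothing. *)
Lemma integral_lorentzian_ge0 (R : realType) (lam : R) : 0 <= lam ->
  (\int[@lebesgue_measure R]_w (lam / (lam ^+ 2 + w ^+ 2))%:E =
     (if lam != 0 then pi else 0)%:E)%E.
Proof.
rewrite le_eqVlt => /predU1P[<-|lam0].
  by rewrite eqxx; apply: integral0_eq => w _; rewrite mul0r.
by rewrite gt_eqF// integral_lorentzian.
Qed.

(** * The weighted incidence matrix and the Laplacian *)

(** The real matrix W^(1/2) R^T in front of the resolvent; it plays the part of a
square root of the Laplacian. *)
Definition edge_mx (R : realType) (n : nat) (A : 'M[R]_n) (k : nat)
    (src snk : 'I_k -> 'I_n) : 'M[R]_(k, n) :=
  sqrt_weight_mx A src snk *m (incidence_mx R src snk)^T.

Lemma edge_mxE (R : realType) (n : nat) (A : 'M[R]_n) (k : nat)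
    (src snk : 'I_k -> 'I_n) (e : 'I_k) (i : 'I_n) :
  edge_mx A src snk e i = Num.sqrt (A (src e) (snk e)) *
    (if i == src e then 1 else if i == snk e then -1 else 0).
Proof. by rewrite /edge_mx mul_diag_mx !mxE. Qed.

Section Graph.
Context (R : realType) (n : nat) (A : 'M[R]_n) (graphA : connected_wgraph A).
Context (k : nat) (src snk : 'I_k -> 'I_n).
Context (edge_num : oriented_edge_numbering A src snk).

Let B := edge_mx A src snk.

Lemma edge_weight_gt0 e : 0 < A (src e) (snk e).
Proof.
have : [set src e; snk e] \in edges A.
  by case: edge_num => _ <-; apply: imset_f.
rewrite inE => /existsP[i /existsP[j /andP[Aij /eqP E]]].
have neij : i != j by apply: contraTneq Aij => ->; rewrite (wgraph_loopless graphA) ltxx.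
have: i \in [set src e; snk e] by rewrite E !inE eqxx.
have: j \in [set src e; snk e] by rewrite E !inE eqxx orbT.
rewrite !inE => /orP[] /eqP jE /orP[] /eqP iE; rewrite -?jE -?iE //.
- by rewrite jE iE eqxx in neij.
- by rewrite (wgraph_sym graphA).
- by rewrite jE iE eqxx in neij.
Qed.

Lemma edge_ends_neq e : src e != snk e.
Proof.
by apply: contraTneq (edge_weight_gt0 e) => ->; rewrite (wgraph_loopless graphA) ltxx.
Qed.

Lemma edge_numbered i j : 0 < A i j -> exists e, [set src e; snk e] = [set i; j].
Proof.
move=> Aij; have : [set i; j] \in edges A.
  by rewrite inE; apply/existsP; exists i; apply/existsP; exists j; rewrite Aij eqxx.
by case: edge_num => _ <- /imsetP[e _ ->]; exists e.
Qed.

Lemma edge_mx_row_sum e : \sum_i B e i = 0.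
Proof.
have nts : snk e != src e by rewrite eq_sym edge_ends_neq.
under eq_bigr => i _ do rewrite edge_mxE.
rewrite -mulr_sumr (bigD1 (src e))//= eqxx (bigD1 (snk e))//=.
rewrite (negPf nts) eqxx big1 ?addr0 ?subrr ?mulr0// => i.
by case/andP=> /negPf -> /negPf ->.
Qed.

Lemma laplacian_row_sum i : \sum_j laplacian A i j = 0.
Proof.
under eq_bigr => j _ do rewrite !mxE.
rewrite sumrB [X in X - _](bigD1 i)//= eqxx mulr1n.
rewrite [X in _ + X - _]big1 ?addr0 ?subrr// => j.
by rewrite eq_sym => /negPf ->.
Qed.

(** Row e of [B] is nonzero at both i and j only if e joins i and j, and by the
injectivity of the numbering at most one edge does. *)
Lemma edge_mx_offdiag i j : i != j -> (B^T *m B) i j = - A i j.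
Proof.
move=> nij; have ends e : B e i * B e j =
    if [set src e; snk e] == [set i; j] then - A i j else 0.
  rewrite !edge_mxE mulrACA -expr2 sqr_sqrtr ?ltW ?edge_weight_gt0//.
  have nss := edge_ends_neq e.
  case: ([set src e; snk e] =P [set i; j]) => [E|NE].
    have: src e \in [set i; j] by rewrite -E !inE eqxx.
    have: snk e \in [set i; j] by rewrite -E !inE eqxx orbT.
    rewrite !inE => /orP[] /eqP sE /orP[] /eqP tE; rewrite ?sE ?tE ?eqxx;
      rewrite ?sE ?tE ?eqxx // in nss.
    - by rewrite [i == j](negPf nij) mulN1r mulrN1 (wgraph_sym graphA).
    - by rewrite [j == i]eq_sym (negPf nij) mul1r mulrN1.
  have [iE|ni] := eqVneq i (src e); have [jE|nj] := eqVneq j (src e).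
  - by rewrite iE jE eqxx in nij.
  - have [jE'|_] := eqVneq j (snk e); last by rewrite !mulr0.
    by case: NE; rewrite iE jE'.
  - have [iE'|_] := eqVneq i (snk e); last by rewrite mul0r mulr0.
    by case: NE; rewrite iE' jE finset.setUC.
  - have [iE'|_] := eqVneq i (snk e); last by rewrite mul0r mulr0.
    have [jE'|_] := eqVneq j (snk e); last by rewrite !mulr0.
    by rewrite iE' jE' eqxx in nij.
rewrite mxE; under eq_bigr => e _ do rewrite mxE ends.
have [Aij|] := boolP (0 < A i j); last first.
  rewrite lt_neqAle (wgraph_ge0 graphA) andbT negbK => /eqP <-.
  by rewrite oppr0 big1// => e _; case: ifP.
have [e eE] := edge_numbered Aij.
rewrite (bigD1 e)//= eE eqxx big1 ?addr0// => e' ne'.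
case: ifP => // /eqP; rewrite -eE => /(edge_num.1) E.
by rewrite E eqxx in ne'.
Qed.

(** Both sides have zero row sums, so their diagonals agree as soon as their
off-diagonal entries do. *)
Lemma laplacian_gram : laplacian A = B^T *m B.
Proof.
have off i j : i != j -> laplacian A i j = (B^T *m B) i j.
  by move=> nij; rewrite edge_mx_offdiag// !mxE (negPf nij) mulr0n sub0r.
apply/matrixP => i j; have [<-{j}|] := eqVneq i j; last exact: off.
have BTB0 : \sum_j (B^T *m B) i j = 0.
  under eq_bigr => j _ do rewrite mxE.
  rewrite exchange_big big1//= => e _.
  by rewrite -mulr_sumr edge_mx_row_sum mulr0.
have := laplacian_row_sum i; rewrite -[RHS]BTB0 (bigD1 i)//= [RHS](bigD1 i)//=.
rewrite (eq_bigr (fun j => (B^T *m B) i j)); first exact: addIr.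
by move=> j ji; apply: off; rewrite eq_sym.
Qed.

(** The only use of connectedness: [B *m u = 0] says that u takes the same value
at both ends of every edge, hence along every path. *)
Lemma edge_mx_ker (u : 'cV[R[i]]_n) :
  map_mx (real_complex R) B *m u = 0 -> forall i j, u i 0 = u j 0.
Proof.
move=> Bu0 i j; have edge_eq e : u (src e) 0 = u (snk e) 0.
  have nts : snk e != src e by rewrite eq_sym edge_ends_neq.
  have BE l : map_mx (real_complex R) B e l = real_complex R (B e l).
    by rewrite mxE.
  move/matrixP: Bu0 => /(_ e 0); rewrite mxE (bigD1 (src e))//=.
  rewrite (bigD1 (snk e))//= big1 ?addr0; last first.
    by move=> l /andP[/negPf ls /negPf lt]; rewrite BE edge_mxE ls lt mulr0 mul0r.
  rewrite !BE !edge_mxE mxE eqxx (negPf nts) eqxx.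
  rewrite mulr1 mulrN1 rmorphN mulNr -mulrBr => /eqP.
  rewrite mulf_eq0 fmorph_eq0 sqrtr_eq0 leNgt edge_weight_gt0/= subr_eq0.
  by move/eqP.
have := wgraph_connected graphA i j => /connectP[p + ->].
elim: p i => //= l p IHp i /andP[/edge_numbered[e eE] /IHp <-].
have: i \in [set src e; snk e] by rewrite eE !inE eqxx.
have: l \in [set src e; snk e] by rewrite eE !inE eqxx orbT.
by rewrite !inE => /orP[] /eqP -> /orP[] /eqP ->; rewrite ?edge_eq.
Qed.

End Graph.

(** * Complex matrices and their adjoints *)

(** The squared modulus as an element of [R]; the norm of [R[i]] is valued in
[R[i]], whereas the integrands have to be real. *)
Definition sqmod (R : realType) (z : R[i]) : R := complex.Re z ^+ 2 + complex.Im z ^+ 2.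

Lemma sqmod_ge0 (R : realType) (z : R[i]) : 0 <= sqmod z.
Proof. by rewrite addr_ge0 ?sqr_ge0. Qed.

Lemma sqmod_eq0 (R : realType) (z : R[i]) : (sqmod z == 0) = (z == 0).
Proof. by case: z => x y; rewrite eq_complex/= paddr_eq0 ?sqr_ge0// !sqrf_eq0. Qed.

Lemma mul_conj_sqmod (R : realType) (z : R[i]) :
  Num.conj z * z = real_complex R (sqmod z).
Proof. by rewrite mulrC -normCK -add_Re2_Im2. Qed.

Local Open Scope sesquilinear_scope.
Local Notation complexify := (map_mx (real_complex _)).

Lemma adjmxM (R : realType) (m n p : nat) (X : 'M[R[i]]_(m, n)) (Y : 'M[R[i]]_(n, p)) :
  (X *m Y)^t* = Y^t* *m X^t*.
Proof. by rewrite trmx_mul map_mxM. Qed.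

Lemma adjmxK (R : realType) (m n : nat) (X : 'M[R[i]]_(m, n)) : X^t*^t* = X.
Proof. exact: trmxCK. Qed.

Lemma conj_real (R : realType) (x : R) : Num.conj (real_complex R x) = real_complex R x.
Proof. exact: conjc_real. Qed.

Lemma adjmx_complexify (R : realType) (m n : nat) (X : 'M[R]_(m, n)) :
  (complexify X)^t* = complexify X^T.
Proof. by apply/matrixP => i j; rewrite !mxE conj_real. Qed.

Lemma gram_diag (R : realType) (m n : nat) (X : 'M[R[i]]_(m, n)) (a : 'I_n) :
  (X^t* *m X) a a = real_complex R (\sum_e sqmod (X e a)).
Proof.
by rewrite mxE rmorph_sum; apply: eq_bigr => e _; rewrite !mxE mul_conj_sqmod.
Qed.

Lemma sqmodV (R : realType) (z : R[i]) : sqmod z^-1 = (sqmod z)^-1.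
Proof.
apply: (@complexI R); rewrite fmorphV -[LHS]mul_conj_sqmod fmorphV -invfM.
by rewrite mul_conj_sqmod.
Qed.

(** The middle factor [Y^t* *m Y] is diagonal, so the trace splits into a sum of
squared moduli of entries of [N], weighted by the diagonal. *)
Lemma mxtrace_gram_diag (R : realType) (k n m : nat) (Y : 'M[R[i]]_(k, n))
    (d : 'rV[R]_n) (g : 'rV[R[i]]_n) (N : 'M[R[i]]_(n, m)) :
  Y^t* *m Y = diag_mx (complexify d) ->
  \tr ((Y *m diag_mx g *m N)^t* *m (Y *m diag_mx g *m N)) =
  real_complex R (\sum_l \sum_a sqmod (N a l) * (d 0 a * sqmod (g 0 a))).
Proof.
move=> YY.
have -> : (Y *m diag_mx g *m N)^t* *m (Y *m diag_mx g *m N) =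
    N^t* *m (diag_mx (\row_a real_complex R (d 0 a * sqmod (g 0 a))) *m N).
  rewrite 2!adjmxM -!mulmxA; congr (_ *m _); rewrite [Y^t* *m _]mulmxA YY !mulmxA.
  congr (_ *m _); rewrite tr_diag_mx map_diag_mx !mulmx_diag.
  congr diag_mx; apply/rowP => a.
  by rewrite !mxE mulrAC mul_conj_sqmod -rmorphM mulrC.
rewrite rmorph_sum; apply: eq_bigr => l _; rewrite mxE rmorph_sum.
apply: eq_bigr => a _.
by rewrite mul_diag_mx !mxE mulrCA mul_conj_sqmod -rmorphM mulrC.
Qed.

(** * Spectral decomposition of the Laplacian *)

Section Spectrum.
Context (R : realType) (n : nat) (A : 'M[R]_n) (graphA : connected_wgraph A).
Context (k : nat) (src snk : 'I_k -> 'I_n).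
Context (edge_num : oriented_edge_numbering A src snk).

Let B := complexify (edge_mx A src snk).
Let L := complexify (laplacian A).

Lemma laplacian_gramC : L = B^t* *m B.
Proof.
by rewrite adjmx_complexify -map_mxM -(laplacian_gram graphA edge_num).
Qed.

(** The spectral theorem for L, in terms of [B *m U]: the columns of [B *m U] are
orthogonal, and the eigenvalues are their squared lengths.  This makes the
eigenvalues real and nonnegative, and shows that [B] kills the eigenvectors of
eigenvalue 0. *)
Lemma laplacian_diagonalization : exists (U : 'M[R[i]]_n) (lam : 'rV[R]_n),
  [/\ U \is unitarymx, forall a, 0 <= lam 0 a &
      (B *m U)^t* *m (B *m U) = diag_mx (complexify lam)].
Proof.
have normalL : L \is normalmx.
  by apply/normalmxP; rewrite laplacian_gramC adjmxM adjmxK.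
have /orthomx_spectralP := normalL.
set P := spectralmx L; set d := spectral_diag L => LE.
have uP : P \is unitarymx := spectral_unitarymx L.
have gramE : (B *m P^t*)^t* *m (B *m P^t*) = diag_mx d.
  rewrite adjmxM adjmxK mulmxA -[P *m _ *m B]mulmxA -laplacian_gramC LE.
  by rewrite -(invmx_unitary uP) !mulmxA mulmxV ?unitarymx_unit// mul1mx
             mulmxK ?unitarymx_unit.
have dE a : d 0 a = real_complex R (\sum_e sqmod ((B *m P^t*) e a)).
  by rewrite -gram_diag gramE mxE eqxx mulr1n.
exists (P^t*), (\row_a \sum_e sqmod ((B *m P^t*) e a)); split.
- by rewrite trmxC_unitary.
- by move=> a; rewrite mxE sumr_ge0// => e _; exact: sqmod_ge0.
- by rewrite gramE; congr diag_mx; apply/rowP => a; rewrite !mxE dE.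
Qed.

Context (U : 'M[R[i]]_n) (lam : 'rV[R]_n).
Context (unitaryU : U \is unitarymx).
Context (gramU : (B *m U)^t* *m (B *m U) = diag_mx (complexify lam)).

Lemma eigenE : L *m U = U *m diag_mx (complexify lam).
Proof.
have UUs := unitarymxP unitaryU.
by rewrite -gramU adjmxM laplacian_gramC !mulmxA UUs mul1mx.
Qed.

Lemma kernel_eigenvector_const a : lam 0 a = 0 -> forall i j, U i a = U j a.
Proof.
move=> la0; have BU0 e : (B *m U) e a = 0.
  apply/eqP; rewrite -sqmod_eq0; apply/eqP.
  have := gram_diag (B *m U) a; rewrite gramU mxE eqxx mulr1n mxE la0 => /complexI.
  by move/esym/psumr_eq0P => ->// e' _; exact: sqmod_ge0.
have Bcol0 : B *m col a U = 0.
  by rewrite colE mulmxA -colE; apply/colP => e; rewrite [LHS]mxE BU0 mxE.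
by move=> i j; have := edge_mx_ker graphA edge_num Bcol0 i j; rewrite !mxE.
Qed.

(** L is symmetric with zero row sums, so the all-ones row vector annihilates it;
applied to L u = lam u this gives lam times the sum of u equal to 0. *)
Lemma nonkernel_eigenvector_sum a : lam 0 a != 0 -> \sum_j U j a = 0.
Proof.
have Lsym : (laplacian A)^T = laplacian A.
  by rewrite (laplacian_gram graphA edge_num) trmx_mul trmxK.
move=> la0; have : \sum_j (L *m U) j a = 0.
  under eq_bigr => j _ do rewrite mxE.
  rewrite exchange_big big1//= => i _; rewrite -mulr_suml.
  have -> : \sum_j L j i = real_complex R (\sum_j laplacian A i j).
    rewrite rmorph_sum; apply: eq_bigr => j _; rewrite mxE; congr (real_complex R _).
    by rewrite -[in LHS]Lsym mxE.
  by rewrite laplacian_row_sum rmorph0 mul0r.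
rewrite eigenE mul_mx_diag; under eq_bigr => j _ do rewrite !mxE.
rewrite -mulr_suml => /eqP; rewrite mulf_eq0 fmorph_eq0 (negPf la0) orbF.
by move/eqP.
Qed.

(** The rows of [U] are orthonormal.  Summing the inner products of row i with all
rows j gives 1; the columns with nonzero eigenvalue drop out of this sum as
their entries add up to 0, and each constant column contributes n times
|U_(i, a)|^2.  Hence the kernel accounts for 1/n of the unit length of row i,
for every i. *)
Lemma nonkernel_weight i : \sum_(a | lam 0 a != 0) sqmod (U i a) = 1 - n%:R^-1.
Proof.
have UUs := unitarymxP unitaryU.
have UUsE j : \sum_a U i a * Num.conj (U j a) = (i == j)%:R.
  have /matrixP/(_ i j) := UUs; rewrite !mxE => <-.
  by apply: eq_bigr => a _; rewrite !mxE.
have total : \sum_a sqmod (U i a) = 1.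
  apply: (@complexI R); rewrite rmorph_sum rmorph1.
  transitivity (\sum_a U i a * Num.conj (U i a)); last by rewrite UUsE eqxx.
  by apply: eq_bigr => a _; rewrite mulrC mul_conj_sqmod.
have kernel : n%:R * \sum_(a | lam 0 a == 0) sqmod (U i a) = 1.
  apply: (@complexI R); rewrite rmorphM rmorph_nat rmorph_sum rmorph1.
  transitivity (\sum_j \sum_a U i a * Num.conj (U j a)); last first.
    under eq_bigr => j _ do rewrite UUsE.
    by rewrite (bigD1 i)//= eqxx big1 ?addr0// => j /negPf; rewrite eq_sym => ->.
  rewrite [RHS]exchange_big/= [RHS](bigID (fun a => lam 0 a == 0))/=.
  rewrite [X in _ = _ + X]big1.
    rewrite addr0 mulr_sumr; apply: eq_bigr => a /eqP la0.
    rewrite (eq_bigr (fun=> real_complex R (sqmod (U i a)))).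
      by rewrite sumr_const card_ord mulr_natl.
    by move=> j _; rewrite (kernel_eigenvector_const la0 j i) mulrC mul_conj_sqmod.
  move=> a la0; rewrite -mulr_sumr -rmorph_sum nonkernel_eigenvector_sum//.
  by rewrite rmorph0 mulr0.
have n0 : n%:R != 0 :> R.
  by apply/eqP => n0; move: kernel; rewrite n0 mul0r => /esym/eqP; rewrite oner_eq0.
move: total; rewrite (bigID (fun a => lam 0 a == 0))/=.
rewrite -[X in X + _ = _](mulKf n0) kernel mulr1 => /(canRL (addKr _)) ->.
by rewrite addrC.
Qed.

Lemma resolvent_diag (w : R) : w != 0 ->
  invmx ((Complex 0 w)%:M + L) =
  U *m diag_mx (\row_a (Complex (lam 0 a) w)^-1) *m U^t*.
Proof.
move=> w0; have UUs := unitarymxP unitaryU.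
set X := _ + L; set Y := RHS.
(* No eigenvalue lam_a + i w vanishes, as its imaginary part is w. *)
suff XY : X *m Y = 1%:M.
  by rewrite -[RHS]mul1mx -(mulVmx (mulmx1_unit XY).1) -mulmxA XY mulmx1.
rewrite /X /Y !mulmxA mulmxDl eigenE -scalar_mxC -mulmxDr -[U *m _ *m diag_mx _]mulmxA.
rewrite (_ : _ *m diag_mx _ = 1%:M) ?mulmx1//.
rewrite -diag_const_mx -[_ + _](raddfD (@diag_mx _ n)) mulmx_diag -diag_const_mx.
congr diag_mx; apply/rowP => a; rewrite !mxE.
have -> : Complex 0 w + real_complex R (lam 0 a) = Complex (lam 0 a) w.
  by rewrite /real_complex_def; simpc.
by rewrite mulfV// eq_complex/= negb_and w0 orbT.
Qed.

(** * The H2 norm of the network *)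

(** In the eigenbasis, the squared Frobenius norm weighs lam_a (from
B^* B) against |i w + lam_a|^-2 (from the resolvent and its adjoint). *)
Lemma frobenius_transfer (m : nat) (K : {set 'I_m}) (v : 'I_m -> 'I_n) (w : R) :
  w != 0 -> (forall a, 0 <= lam 0 a) ->
  frobenius_norm (transfer A src snk (new_leader_mx R (~: K) v) (Complex 0 w)) ^+ 2 =
  \sum_(l in K) \sum_a sqmod (U (v l) a) * (lam 0 a / (lam 0 a ^+ 2 + w ^+ 2)).
Proof.
move=> w0 lam0; set rhs := RHS.
have rhs0 : 0 <= rhs.
  apply: sumr_ge0 => l _; apply: sumr_ge0 => a _.
  by rewrite mulr_ge0 ?sqmod_ge0 ?divr_ge0 ?addr_ge0 ?sqr_ge0.
set H := transfer _ _ _ _ _.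
suff -> : frobenius_norm H = Num.sqrt rhs by rewrite sqr_sqrtr.
congr Num.sqrt; suff -> : \tr ((map_mx Num.conj H)^T *m H) = real_complex R rhs by [].
have -> : H = B *m U *m diag_mx (\row_a (Complex (lam 0 a) w)^-1)
    *m (U^t* *m complexify (new_leader_mx R (~: K) v)).
  by rewrite /H /transfer resolvent_diag// !mulmxA.
rewrite map_trmx (mxtrace_gram_diag _ _ gramU); congr (real_complex R _).
rewrite /rhs [RHS]big_mkcond; apply: eq_bigr => l _.
have colUM a : (U^t* *m complexify (new_leader_mx R (~: K) v)) a l =
    if l \in K then Num.conj (U (v l) a) else 0.
  rewrite mxE (bigD1 (v l))//= big1 ?addr0 => [|i /negPf vi].
    rewrite !mxE eqxx andbT finset.in_setC negbK.
    by case: ifP => _; rewrite (rmorph0, rmorph1) (mulr0, mulr1).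
  by rewrite !mxE vi andbF rmorph0 mulr0.
case: ifP => lK; last first.
  by rewrite big1// => a _; rewrite colUM lK /sqmod/= expr0n addr0 mul0r.
apply: eq_bigr => a _; rewrite colUM lK mxE sqmodV; congr (_ * _).
by apply: (@complexI R); rewrite -!mul_conj_sqmod conjCK mulrC.
Qed.

End Spectrum.

(** Integrating termwise replaces the Lorentzians by pi or 0, and what remains of
leader l is the weight [nonkernel_weight], which is the same for all vertices. *)
Lemma H2norm_transfer (R : realType) (n : nat) (A : 'M[R]_n)
    (graphA : connected_wgraph A) (k : nat) (src snk : 'I_k -> 'I_n)
    (edge_num : oriented_edge_numbering A src snk)
    (m : nat) (K : {set 'I_m}) (v : 'I_m -> 'I_n) :
  H2norm (transfer A src snk (new_leader_mx R (~: K) v)) =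
  (Num.sqrt (#|K|%:R * ((1 - n%:R^-1) / 2)))%:E.
Proof.
have [U [lam [unitaryU lam0 gramU]]] := laplacian_diagonalization graphA edge_num.
set H := transfer _ _ _ _.
pose f l a (w : R) : \bar R := ((sqmod (U (v l) a))%:E *
  (lam 0 a / (lam 0 a ^+ 2 + w ^+ 2))%:E)%E.
have f0 l a w : (0 <= f l a w)%E.
  by rewrite mule_ge0// lee_fin ?sqmod_ge0 ?divr_ge0 ?addr_ge0 ?sqr_ge0.
have mf l a : measurable_fun [set: R] (f l a).
  by apply: measurable_funeM; apply/measurable_EFinP; exact: measurable_lorentzian.
have msum l : measurable_fun [set: R] (fun w => (\sum_(a < n) f l a w)%E).
  exact: emeasurable_sum.
have mtot : measurable_fun [set: R]
    (fun w => (\sum_(l <- enum K) \sum_(a < n) f l a w)%E).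
  exact: emeasurable_sum.
have HE (w : R) : w \in [set~ 0]%classic ->
    (frobenius_norm (H ('i * real_complex R w)) ^+ 2)%:E =
    (\sum_(l <- enum K) \sum_(a < n) f l a w)%E.
  rewrite inE/= => /eqP w0.
  have -> : 'i * real_complex R w = Complex 0 w.
    by rewrite -['i]/(Complex 0 1); simpc.
  rewrite (frobenius_transfer graphA edge_num unitaryU gramU)// -big_enum.
  by rewrite -sumEFin; apply: eq_bigr => l _; rewrite -sumEFin.
(* At w = 0 the matrix s I + L is singular and HE may fail, so the integral is
   moved to the complement of this null set, rewritten there, and moved back. *)
have D0 : ([set: R] `\ 0 = [set~ 0])%classic by rewrite setTD.
have mD0 : measurable ([set: R] `\ 0)%classic by exact: measurableD.
rewrite /H2norm -(@integral_setD1 _ _ 0)//; last first.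
  rewrite D0; apply: eq_measurable_fun (measurable_funTS mtot) => w w0.
  by rewrite HE.
rewrite D0; under eq_integral => w w0 do rewrite HE//.
rewrite -D0 integral_setD1//; last exact: measurable_funTS.
rewrite ge0_integral_sum//; last first.
  by move=> l w _; exact: sume_ge0.
rewrite (eq_bigr (fun=> (pi * (1 - n%:R^-1))%:E)) => [|l _]; last first.
  rewrite ge0_integral_sum//; last exact: mf.
  under eq_bigr => a _.
    rewrite ge0_integralZl_EFin ?sqmod_ge0//; last 2 first.
    - by move=> w _; rewrite lee_fin divr_ge0 ?addr_ge0 ?sqr_ge0.
    - by apply/measurable_EFinP; exact: measurable_lorentzian.
    rewrite integral_lorentzian_ge0// -EFinM; over.
  rewrite sumEFin -(nonkernel_weight graphA edge_num unitaryU gramU (v l)).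
  rewrite mulr_sumr [in RHS]big_mkcond; congr EFin; apply: eq_bigr => a _.
  by case: ifP => _; rewrite ?mulr0 1?mulrC.
rewrite sumEFin big_enum sumr_const -EFinM/=; congr (Num.sqrt _)%:E.
have pi0 : pi != 0 :> R by rewrite gt_eqF ?pi_gt0.
by rewrite -[_ *+ #|K|]mulr_natl; move: (1 - _) (@pi R) pi0 => c p p0; field.
Qed.

(** * Demoting leaders *)

Theorem corollary1 (R : realType) (n : nat) (n_gt1 : (1 < n)%N)
    (A : 'M[R]_n) (graphA : connected_wgraph A)
    (k : nat) (src snk : 'I_k -> 'I_n)
    (edge_num : oriented_edge_numbering A src snk)
    (m : nat) (v : 'I_m -> 'I_n) (v_inj : injective v)
    (r : nat) (r_range : (1 <= r <= m)%N)
    (Vdem : {set 'I_n}) (Vdem_sub : Vdem \subset [set v l | l : 'I_m])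
    (card_Vdem : #|Vdem| = r)
    (vt : 'I_m -> 'I_n) (vtE : forall l, v l \notin Vdem -> vt l = v l) :
  let J := [set l | v l \in Vdem] in
  let G := transfer A src snk (leader_mx R v) in
  let Gt := transfer A src snk (new_leader_mx R J vt) in
  (H2norm (fun s => G s - Gt s)%R / H2norm G
     = (Num.sqrt (r%:R / m%:R))%:E)%E.
Proof.
move=> J G Gt.
have cardJ : #|J| = r.
  rewrite -card_Vdem -(card_imset _ v_inj); congr #|pred_of_set _|.
  apply/setP => i; apply/imsetP/idP => [[l + ->]|iV]; first by rewrite inE.
  have /imsetP[l _ il] := fintype.subsetP Vdem_sub i iV.
  by exists l; rewrite // inE -il.
(* new_leader_mx names the columns that vanish, hence the complements here. *)
have GE : G = transfer A src snk (new_leader_mx R (~: [set: 'I_m]) v).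
  rewrite /G; congr transfer; apply/matrixP => i l.
  by rewrite !mxE finset.in_setC finset.in_setT.
have diffE : (fun s => G s - Gt s) = transfer A src snk (new_leader_mx R (~: J) v).
  apply/funext => s; rewrite /G /Gt /transfer -mulmxBr -map_mxB.
  congr (_ *m map_mx _ _); apply/matrixP => i l.
  rewrite !mxE finset.in_setC; case: (boolP (l \in J)) => lJ/=; first by rewrite subr0.
  by rewrite vtE ?subrr//; move: lJ; rewrite inE.
have m0 : m%:R != 0 :> R.
  by rewrite pnatr_eq0 -lt0n; case/andP: r_range => /leq_trans; apply.
set c := (1 - n%:R^-1) / 2 : R.
have c0 : 0 < c.
  by rewrite divr_gt0// subr_gt0 invf_lt1 ?ltr1n// ltr0n (ltn_trans _ n_gt1).
have mc0 : 0 < m%:R * c by rewrite mulr_gt0// lt_neqAle eq_sym m0 ler0n.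
have rc0 : 0 <= r%:R * c by apply: mulr_ge0; [exact: ler0n | exact: ltW].
rewrite diffE GE !(H2norm_transfer graphA edge_num) cardJ cardsT card_ord -/c.
rewrite inver gt_eqF ?sqrtr_gt0// -EFinM -sqrtrV ?ltW// -sqrtrM//.
by rewrite -mulf_div divff ?mulr1// gt_eqF.
Qed.
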